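(* Let $n,K\ge 1$ be integers, let $\pi_1,\dots,\pi_K>0$ with $\sum_{c=1}^K\pi_c=1$, and let $f_1,\dots,f_K$ be probability densities on $\mathbb{R}^n$ (with respect to Lebesgue measure). Let $C$ be a random variable on $\{1,\dots,K\}$ with $\mathbb{P}(C=c)=\pi_c$, and let $X\in\mathbb{R}^n$ be such that, conditionally on $C=c$, $X$ has density $f_c$; thus $X$ has the mixture density $p_X(x)=\sum_{c=1}^K\pi_c f_c(x)$. Assume that the differential entropies $h(X)$ and $h(f_1),\dots,h(f_K)$ exist and are finite. Then $$h(X\mid C)\ \le\ h(X)\ \le\ h(X\mid C)+H(C).$$
   Context: For a probability density $f$ on $\mathbb{R}^n$, the differential entropy (in bits) is $h(f)=-\int_{\mathbb{R}^n} f(x)\log_2 f(x)\,dx$, with the convention $0\log_2 0=0$; $h(X)$ denotes $h(p_X)$. The conditional entropy is $h(X\mid C)=\sum_{c=1}^K\pi_c h(f_c)$, and $H(C)=-\sum_{c=1}^K\pi_c\log_2\pi_c$. *)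

(* Defs.v *)
From HB Require Import structures.
From mathcomp Require Import all_boot all_order all_algebra.
From mathcomp Require Import all_classical all_reals all_analysis.

Set Implicit Arguments.
Unset Strict Implicit.
Unset Printing Implicit Defensive.
Import Order.TTheory GRing.Theory Num.Theory.
Import numFieldNormedType.Exports.

Local Open Scope classical_set_scope.
Local Open Scope ring_scope.

(* R^n with its Borel sigma-algebra, generated by the n coordinates. *)
Notation Rvec R n := (n.-tuple (measurableTypeR R)).

Definition tuple_cons (R : realType) (n : nat)
  (x : measurableTypeR R * Rvec R n) : Rvec R n.+1 := [tuple of x.1 :: x.2].

Lemma measurable_tuple_cons (R : realType) n :
  measurable_fun [set: measurableTypeR R * Rvec R n] (@tuple_cons R n).
Proof. exact: measurable_cons. Qed.

Section lebesgue_cons.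
Context {R : realType} (n : nat).
Variable m : {sigma_finite_measure set (Rvec R n) -> \bar R}.
Local Open Scope ereal_scope.

Let uncons (t : Rvec R n.+1) : measurableTypeR R * Rvec R n :=
  (thead t, [tuple of behead t]).

Let consK : cancel (@tuple_cons R n) uncons.
Proof. by case=> x t; congr pair; apply/val_inj. Qed.

Let measurable_uncons : measurable_fun setT uncons.
Proof.
apply/measurable_fun_pair; last exact: measurable_behead.
exact: measurable_tnth.
Qed.

Definition lebesgue_cons : set (Rvec R n.+1) -> \bar R :=
  pushforward (@lebesgue_measure R \x m) (@tuple_cons R n).

Let lebesgue_cons0 : lebesgue_cons set0 = 0.
Proof. by rewrite /lebesgue_cons /pushforward preimage_set0 measure0. Qed.

Let lebesgue_cons_ge0 A : 0 <= lebesgue_cons A.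
Proof. by rewrite /lebesgue_cons /pushforward measure_ge0. Qed.

Let lebesgue_cons_sigma_additive : semi_sigma_additive lebesgue_cons.
Proof.
pose mc := isMeasurableFun.Build _ _ _ _ _ (@measurable_tuple_cons R n).
pose c : {mfun _ >-> _} := HB.pack (@tuple_cons R n) mc.
exact: (@measure_semi_sigma_additive _ _ _
  (pushforward (@lebesgue_measure R \x m) c)).
Qed.

HB.instance Definition _ := isMeasure.Build _ _ _ lebesgue_cons
  lebesgue_cons0 lebesgue_cons_ge0 lebesgue_cons_sigma_additive.

Let lebesgue_cons_sigma_finite : sigma_finite setT lebesgue_cons.
Proof.
have /sigma_finiteP[F [TF ndF Foo]] := sigma_finiteT (@lebesgue_measure R).
have /sigma_finiteP[G [TG ndG Goo]] := sigma_finiteT m.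
exists (fun k => uncons @^-1` (F k `*` G k)).
  apply/esym/seteqP; split => // t _.
  have [i _ Fi] : (\bigcup_i F i) (uncons t).1 by rewrite -TF.
  have [j _ Gj] : (\bigcup_j G j) (uncons t).2 by rewrite -TG.
  exists (maxn i j) => //; split.
    by move: (_.1) Fi; exact/subsetPset/ndF/leq_maxl.
  by move: (_.2) Gj; exact/subsetPset/ndG/leq_maxr.
move=> k; have [mF Fk] := Foo k; have [mG Gk] := Goo k; split.
  by rewrite -[X in measurable X]setTI; apply: measurable_uncons => //;
    exact: measurableX.
rewrite /lebesgue_cons /pushforward -comp_preimage.
rewrite (_ : uncons \o _ = id); last by apply/funext => x /=; rewrite consK.
by rewrite preimage_id product_measure1E// lte_mul_pinfty// ge0_fin_numE.
Qed.

HB.instance Definition _ := Measure_isSigmaFinite.Build _ _ _ lebesgue_cons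
  lebesgue_cons_sigma_finite.

End lebesgue_cons.

(* Lebesgue measure on R^n, as the n-fold product of the one-dimensional one;
   lebesgue_vec_box below gives its value on boxes. *)
Fixpoint lebesgue_vec (R : realType) (n : nat) :
    {sigma_finite_measure set (Rvec R n) -> \bar R} :=
  match n with
  | 0 => dirac ([tuple] : Rvec R 0)
  | n'.+1 => lebesgue_cons (lebesgue_vec R n')
  end.

Lemma lebesgue_vec_box (R : realType) (n : nat)
    (A : 'I_n -> set (measurableTypeR R)) :
    (forall i, measurable (A i)) ->
  lebesgue_vec R n [set t | forall i, A i (tnth t i)] =
  (\prod_(i < n) lebesgue_measure (A i))%E.
Proof.
elim: n A => [|n IH] A mA.
  rewrite big_ord0 /= diracE mem_set//= => -[].
  by [].
rewrite big_ord_recl /= /lebesgue_cons /pushforward -IH//.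
rewrite -product_measure1E//; last first.
  rewrite (_ : mkset _ = \bigcap_(i in [set: 'I_n])
     ((@tnth _ _)^~ i @^-1` A (lift ord0 i))).
    apply: fin_bigcap_measurable => // i _.
    by rewrite -[X in measurable X]setTI; exact: measurable_tnth.
  by apply/seteqP; split => t /= h i; [move=> _; exact: h|exact: h].
congr (_ _); apply/seteqP; split => -[x t] /=.
  move=> h; split; first by have := h ord0.
  by move=> i; have := h (lift ord0 i); rewrite tnthS.
move=> [h0 h] i; case: (unliftP ord0 i) => [j ->|->]; last by [].
by rewrite tnthS.
Qed.

Definition log2 (R : realType) (x : R) : R := ln x / ln 2.

Definition is_density (R : realType) (n : nat) (f : Rvec R n -> R) : Prop :=
  [/\ measurable_fun setT f,
      forall x, 0 <= f x &
      (\int[lebesgue_vec R n]_x (f x)%:E = 1)%E].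

(* The convention 0 log2 0 = 0 is automatic: 0 * _ = 0. *)
Definition entropy_integrand (R : realType) (n : nat) (f : Rvec R n -> R)
  (x : Rvec R n) : R := f x * log2 (f x).

Definition diff_entropy (R : realType) (n : nat) (f : Rvec R n -> R) : R :=
  - (\int[lebesgue_vec R n]_x entropy_integrand f x)%R.

(* A Lebesgue integral exists and is finite iff its integrand is integrable;
   Rintegral is a junk value otherwise. *)
Definition diff_entropy_finite (R : realType) (n : nat)
  (f : Rvec R n -> R) : Prop :=
  (lebesgue_vec R n).-integrable setT (EFin \o entropy_integrand f).

Definition mixture (R : realType) (n K : nat) (w : 'I_K -> R)
  (f : 'I_K -> Rvec R n -> R) (x : Rvec R n) : R := \sum_(c < K) w c * f c x.

Definition cond_entropy (R : realType) (n K : nat) (w : 'I_K -> R)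
  (f : 'I_K -> Rvec R n -> R) : R := \sum_(c < K) w c * diff_entropy (f c).

Definition shannon_entropy (R : realType) (K : nat) (w : 'I_K -> R) : R :=
  - \sum_(c < K) w c * log2 (w c).

Definition cond_prob (d : measure_display) (T : measurableType d)
  (R : realType) (P : probability T R) (A B : set T) : \bar R :=
  (P (A `&` B) / P B)%E.

Definition has_density (d : measure_display) (T : measurableType d)
  (R : realType) (P : probability T R) (n : nat) (X : {RV P >-> Rvec R n})
  (p : Rvec R n -> R) : Prop :=
  forall B : set (Rvec R n), measurable B ->
    P (X @^-1` B) = (\int[lebesgue_vec R n]_(x in B) (p x)%:E)%E.

Definition has_cond_density (d : measure_display) (T : measurableType d)
  (R : realType) (P : probability T R) (n : nat) (X : {RV P >-> Rvec R n})
  (E : set T) (p : Rvec R n -> R) : Prop :=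
  forall B : set (Rvec R n), measurable B ->
    cond_prob P (X @^-1` B) E =
    (\int[lebesgue_vec R n]_(x in B) (p x)%:E)%E.

(* Main.v *)
(* Both bounds hold pointwise before integration.  With m the mixture density,
   convexity of x log x gives m log m <= sum_c w_c f_c log f_c, while
   w_c f_c <= m and monotonicity of log give
   w_c f_c log (w_c f_c) <= w_c f_c log m, whose sum over c is m log m. *)
Require Import Defs.
From HB Require Import structures.
From mathcomp Require Import all_boot all_order all_algebra.
From mathcomp Require Import all_classical all_reals all_analysis.
From mathcomp Require Import measurable_realfun ring lra.

Set Implicit Arguments.
Unset Strict Implicit.
Unset Printing Implicit Defensive.
Import Order.TTheory GRing.Theory Num.Theory.
Import numFieldNormedType.Exports.

Local Open Scope classical_set_scope.
Local Open Scope ring_scope.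

Lemma ln2_gt0 (R : realType) : 0 < ln 2 :> R.
Proof. by rewrite ln_gt0// ltr1n. Qed.

Lemma ler_log2 (R : realType) (x y : R) : 0 < x -> x <= y -> log2 x <= log2 y.
Proof.
move=> x0 xy; rewrite /log2 ler_pM2r ?invr_gt0 ?ln2_gt0//.
by rewrite ler_ln ?posrE// (lt_le_trans x0).
Qed.

Lemma log2M (R : realType) (x y : R) : 0 < x -> 0 < y ->
  log2 (x * y) = log2 x + log2 y.
Proof. by move=> x0 y0; rewrite /log2 lnM ?posrE// mulrDl. Qed.

(** The left side is the value at [a] of the tangent line to [x * log2 x] at [m]. For [a > 0] the
    bound is [ln t <= t - 1] at [t = m / a], multiplied by [a]. *)
Lemma xlog2x_ge_tangent (R : realType) (a m : R) : 0 <= a -> 0 < m ->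
  a * log2 m + (a - m) / ln 2 <= a * log2 a.
Proof.
rewrite le_eqVlt => /predU1P[<-|a0] m0.
  by rewrite !mul0r add0r sub0r mulNr oppr_le0 divr_ge0 ?ltW ?ln2_gt0.
rewrite /log2 !mulrA -mulrDl ler_pM2r ?invr_gt0 ?ln2_gt0//.
have ma0 : 0 < m / a by rewrite divr_gt0.
have : ln m - ln a <= m / a - 1.
  by rewrite -ln_div ?posrE// -[X in ln X](subrKC 1) le_ln1Dx// ltrBrDr addNr.
move=> /(ler_wpM2l (ltW a0)).
rewrite !mulrBr mulr1 [a * (m / a)]mulrC divfK ?gt_eqF//.
lra.
Qed.

(** Jensen's inequality: average the tangent bounds at the mean [m]. The linear terms cancel because
    the weights sum to 1. *)
Lemma convex_xlog2x (R : realType) (K : nat) (w a : 'I_K -> R) :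
  (forall c, 0 <= w c) -> \sum_(c < K) w c = 1 -> (forall c, 0 <= a c) ->
  (\sum_(c < K) w c * a c) * log2 (\sum_(c < K) w c * a c) <=
  \sum_(c < K) w c * (a c * log2 (a c)).
Proof.
move=> w0 w1 a0; set m := \sum_(c < K) w c * a c.
have wa0 c : 0 <= w c * a c by rewrite mulr_ge0.
have [m_eq0|m_neq0] := eqVneq m 0.
  (* There is no tangent at 0, but a zero mean forces every [w c * a c] to vanish, so both sides are
     0. *)
  rewrite m_eq0 mul0r big1// => c _.
  by rewrite mulrA (psumr_eq0P (fun c _ => wa0 c) m_eq0) ?mul0r.
have m0 : 0 < m by rewrite lt0r m_neq0 sumr_ge0.
rewrite (_ : m * _ = \sum_(c < K) w c * (a c * log2 m + (a c - m) / ln 2)).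
  by apply: ler_sum => c _; rewrite ler_wpM2l// xlog2x_ge_tangent.
under eq_bigr do rewrite mulrDr !mulrA mulrBr.
rewrite big_split/= -!mulr_suml sumrB -mulr_suml w1 mul1r.
by rewrite -/m subrr mul0r addr0 -mulrA.
Qed.

(** The factor [a c] stays in the second sum so that, once [a c] is a density, integration turns
    this sum into the negated entropy of the weights. *)
Lemma le_sum_xlog2x (R : realType) (K : nat) (w a : 'I_K -> R) :
  (forall c, 0 < w c) -> (forall c, 0 <= a c) ->
  \sum_(c < K) w c * (a c * log2 (a c)) + \sum_(c < K) w c * log2 (w c) * a c <=
  (\sum_(c < K) w c * a c) * log2 (\sum_(c < K) w c * a c).
Proof.
move=> w0 a0; rewrite mulr_suml -big_split/=; apply: ler_sum => c _.
(* The logarithm of [w c * a c] splits only for [a c > 0]; at [a c = 0] all terms are 0. *)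
have := a0 c; rewrite le_eqVlt => /predU1P[<-|ac0].
  by rewrite !(mul0r, mulr0) addr0.
have wa0 := mulr_gt0 (w0 c) ac0.
rewrite [X in X <= _](_ : _ = w c * a c * log2 (w c * a c)); last first.
  by rewrite log2M//; ring.
rewrite ler_pM2l// ler_log2// (bigD1 c)//= lerDl sumr_ge0// => i _.
by rewrite mulr_ge0// ltW.
Qed.

Section lincomb.
Context d (T : measurableType d) (R : realType)
  (mu : {measure set T -> \bar R}) (D : set T) (mD : measurable D)
  (K : nat) (w : 'I_K -> R) (g : 'I_K -> T -> R).
Hypothesis ig : forall c, mu.-integrable D (EFin \o g c).

Let iwg c : mu.-integrable D (fun x => (w c * g c x)%:E).
Proof.
under eq_fun do rewrite EFinM.
exact: (integrableZl mD (w c) (ig c)).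
Qed.

Lemma integrable_lincomb :
  mu.-integrable D (EFin \o (fun x => \sum_(c < K) w c * g c x)).
Proof.
rewrite [X in integrable _ _ X](_ : _ =
  (fun x => \sum_(c < K) (w c * g c x)%:E)%E); first exact: integrable_sum.
by apply/funext => x /=; rewrite sumEFin.
Qed.

Lemma integral_lincomb :
  (\int[mu]_(x in D) (\sum_(c < K) w c * g c x)%:E =
   \sum_(c < K) (w c)%:E * \int[mu]_(x in D) (g c x)%:E)%E.
Proof.
under eq_integral do rewrite -sumEFin.
rewrite integral_sum//; apply: eq_bigr => c _.
under eq_integral do rewrite EFinM.
exact: (integralZl mD (ig c)).
Qed.

Lemma Rintegral_lincomb :
  \int[mu]_(x in D) (\sum_(c < K) w c * g c x) =
  \sum_(c < K) w c * \int[mu]_(x in D) g c x.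
Proof.
(* Both sides become [fine] of extended reals; integrability makes each integral finite, so [fine]
   loses nothing. *)
rewrite /Rintegral integral_lincomb -[RHS]/(fine (_%:E)) -sumEFin.
congr fine; apply: eq_bigr => c _; rewrite EFinM fineK//.
exact: (integrable_fin_num mD (ig c)).
Qed.

End lincomb.

Lemma density_integrable (R : realType) (n : nat) (p : Rvec R n -> R) :
  is_density p -> (lebesgue_vec R n).-integrable setT (EFin \o p).
Proof.
move=> [mp p0 p1]; apply/integrableP; split; first exact/measurable_EFinP.
under eq_integral do rewrite /= ger0_norm//.
by rewrite p1 ltry.
Qed.

(** Law of total probability over the partition of [Omega] by the values of [C]. *)
Lemma has_density_mixture (R : realType) (n K : nat) (w : 'I_K -> R)
  (f : 'I_K -> Rvec R n -> R) (d : measure_display)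
  (Omega : measurableType d) (P : probability Omega R) (C : Omega -> 'I_K)
  (X : {RV P >-> Rvec R n}) :
  (forall c, 0 < w c) -> (forall c, is_density (f c)) ->
  (forall c, measurable (C @^-1` [set c])) ->
  (forall c, P (C @^-1` [set c]) = (w c)%:E) ->
  (forall c, has_cond_density X (C @^-1` [set c]) (f c)) ->
  has_density X (mixture w f).
Proof.
move=> w0 fd mC PC Xf B mB.
have mXB := measurable_funPTI X mB.
have -> : X @^-1` B = \big[setU/set0]_(c < K) (X @^-1` B `&` C @^-1` [set c]).
  rewrite -big_distrr/= (_ : \big[setU/set0]_(c < K) _ = setT) ?setIT//.
  by apply/seteqP; split => // t _; rewrite -bigcup_seq; exists (C t) => //=;
    rewrite mem_index_enum.
rewrite measure_bigsetU_ord//; first last.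
- by move=> i j _ _ [t [[_ <-] [_ <-]]].
- by move=> c; exact: measurableI.
rewrite /mixture integral_lincomb//; last first.
  by move=> c; apply: integrableS (density_integrable (fd c)).
(* Multiplying the conditional probability by [w c], which is nonzero, recovers the joint
   probability. *)
apply: eq_bigr => c _; rewrite -Xf// /cond_prob PC muleC.
by rewrite inver gt_eqF// -muleA -EFinM mulVf ?gt_eqF// mule1.
Qed.

Theorem theorem1 (R : realType) (n K : nat) (hn : (1 <= n)%N) (hK : (1 <= K)%N)
  (w : 'I_K -> R) (w_gt0 : forall c, 0 < w c) (w_sum : \sum_(c < K) w c = 1)
  (f : 'I_K -> Rvec R n -> R) (f_density : forall c, is_density (f c))
  (d : measure_display) (Omega : measurableType d) (P : probability Omega R)
  (C : Omega -> 'I_K) (C_meas : forall c, measurable (C @^-1` [set c]))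
  (C_law : forall c, P (C @^-1` [set c]) = (w c)%:E)
  (X : {RV P >-> Rvec R n})
  (X_law : forall c, has_cond_density X (C @^-1` [set c]) (f c))
  (hX_finite : diff_entropy_finite (mixture w f))
  (hf_finite : forall c, diff_entropy_finite (f c)) :
  has_density X (mixture w f) /\
  cond_entropy w f <= diff_entropy (mixture w f)
                   <= cond_entropy w f + shannon_entropy w.
Proof.
split; first exact: has_density_mixture X_law.
have f_ge0 c x : 0 <= f c x by have [] := f_density c.
have f_int c := density_integrable (f_density c).
have f_mass c : \int[lebesgue_vec R n]_x f c x = 1.
  by rewrite /Rintegral; have [_ _ ->] := f_density c.
rewrite /cond_entropy /shannon_entropy /diff_entropy.
under eq_bigr do rewrite mulrN.
(* Cancelling the signs reverses both bounds, so the lower bound on entropy becomes the convexity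
   inequality. *)
rewrite sumrN -opprD -Rintegral_lincomb// !lerN2; apply/andP; split.
  apply: le_Rintegral => //; first exact: integrable_lincomb.
  by move=> x _; apply: convex_xlog2x => // c; exact: ltW.
(* Since each [f c] has mass 1, the constants become integrals, and the whole left side merges into
   one integral that can be compared pointwise. *)
rewrite [X in _ + X <= _](_ : _ = \sum_(c < K) w c * log2 (w c) *
    \int[lebesgue_vec R n]_x f c x); last first.
  by apply: eq_bigr => c _; rewrite f_mass mulr1.
rewrite -Rintegral_lincomb// -RintegralD//; try exact: integrable_lincomb.
apply: le_Rintegral => // [|x _]; last exact: le_sum_xlog2x.
have := integrableD measurableT (integrable_lincomb measurableT w hf_finite)
  (integrable_lincomb measurableT (fun c => w c * log2 (w c)) f_int).
exact.
Qed.
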